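(* Let $\{P_t\}_{t\ge0}$ be a non-ergodic symmetric Markov semigroup on $L^2(\mu)$ with Dirichlet form $(D,\mathscr D(D))$ (not necessarily regular). Then $$\lambda_0=\inf\{D(f):\ f\in\mathscr D(D),\ \|f\|=1\}$$ is the largest $\varepsilon$ such that $$\|P_tf\|\le\|f\|\,e^{-\varepsilon t}\qquad\text{for all }t\ge0\text{ and all }f\in L^2(\mu).$$
   Context: $\mu$ is a $\sigma$-finite measure, $\|\cdot\|$ and $(\cdot,\cdot)$ are the norm and inner product of the real Hilbert space $L^2(\mu)$. $\{P_t\}$ is a strongly continuous, symmetric, (sub-)Markovian contraction semigroup on $L^2(\mu)$, with associated Dirichlet form $D(f)=\lim_{t\downarrow0}\frac1t(f-P_tf,f)$ (increasing limit), $\mathscr D(D)$ being the set of $f\in L^2(\mu)$ for which this limit is finite. ''Non-ergodic'' means that it is not the case that $\mu$ is finite and $P_tf\to\int f\,d\mu/\mu(X)$ as $t\to\infty$ for all $f\in L^2(\mu)$, where $X$ is the state space. *)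

(* Defs.v *)
From HB Require Import structures.
From mathcomp Require Import all_boot all_order all_algebra.
From mathcomp Require Import all_classical all_reals all_analysis.

Set Implicit Arguments.
Unset Strict Implicit.
Unset Printing Implicit Defensive.

Import Order.TTheory GRing.Theory Num.Theory.
Import numFieldNormedType.Exports.

Local Open Scope classical_set_scope.
Local Open Scope ring_scope.

(* Elements of [L2 mu] are square-integrable functions, not classes (the
   library's quotient [LspaceType2 mu] has no vector space structure). Hence
   identities in L^2(mu) are stated mu-almost everywhere, and operators on
   L^2(mu) are required to respect a.e. equality. *)
Notation L2 mu := (LfunType mu (lee1n 2)).

Definition L2norm (d : measure_display) (T : measurableType d) (R : realType)
    (mu : {measure set T -> \bar R}) (f : T -> R) : R :=
  fine 'N[mu]_2%:E[EFin \o f].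

Definition L2inner (d : measure_display) (T : measurableType d) (R : realType)
    (mu : {measure set T -> \bar R}) (f g : T -> R) : R :=
  \int[mu]_x (f x * g x).

(* [P t] is only constrained for [0 <= t]. [Markov] is understood as
   sub-Markovian: [P t 1 = 1] is not required. *)
Record symmetric_Markov_semigroup (d : measure_display) (T : measurableType d)
    (R : realType) (mu : {measure set T -> \bar R}) (P : R -> L2 mu -> L2 mu) :
    Prop := SymmetricMarkovSemigroup {
  semigroup_ae_eq : forall (t : R) (f g : L2 mu), 0 <= t ->
    f = g %[ae mu] -> P t f = P t g %[ae mu] ;
  semigroup_linear : forall (t a : R) (f g : L2 mu), 0 <= t ->
    P t (a *: f + g) = (fun x => a * P t f x + P t g x) %[ae mu] ;
  semigroup0 : forall f : L2 mu, P 0 f = f %[ae mu] ;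
  semigroupD : forall (s t : R) (f : L2 mu), 0 <= s -> 0 <= t ->
    P (s + t) f = P s (P t f) %[ae mu] ;
  semigroup_contraction : forall (t : R) (f : L2 mu), 0 <= t ->
    L2norm mu (P t f) <= L2norm mu f ;
  semigroup_strongly_continuous : forall f : L2 mu,
    L2norm mu (P t f \- f) @[t --> 0^'+] --> 0 ;
  semigroup_symmetric : forall (t : R) (f g : L2 mu), 0 <= t ->
    L2inner mu (P t f) g = L2inner mu f (P t g) ;
  semigroup_sub_Markovian : forall (t : R) (f : L2 mu), 0 <= t ->
    {ae mu, forall x, 0 <= f x <= 1} -> {ae mu, forall x, 0 <= P t f x <= 1}
}.

(* For [mu setT = 0] the quotient below is 0, and every semigroup is ergodic,
   as befits the zero space. *)
Definition ergodic (d : measure_display) (T : measurableType d) (R : realType)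
    (mu : {measure set T -> \bar R}) (P : R -> L2 mu -> L2 mu) : Prop :=
  (mu setT < +oo)%E /\
  forall f : L2 mu,
    L2norm mu (fun x => P t f x - (\int[mu]_y f y) / fine (mu setT))
      @[t --> +oo] --> 0.

(* Under [symmetric_Markov_semigroup] the difference quotients increase as [t]
   decreases to 0, so the limit exists in the extended reals. *)
Definition Dirichlet_form (d : measure_display) (T : measurableType d)
    (R : realType) (mu : {measure set T -> \bar R}) (P : R -> L2 mu -> L2 mu)
    (f : L2 mu) : \bar R :=
  lim ((t^-1 * L2inner mu (f \- P t f) f)%:E @[t --> 0^'+]).

Definition Dirichlet_domain (d : measure_display) (T : measurableType d)
    (R : realType) (mu : {measure set T -> \bar R}) (P : R -> L2 mu -> L2 mu) :
    set (L2 mu) :=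
  [set f | Dirichlet_form P f \is a fin_num].

Definition lambda0 (d : measure_display) (T : measurableType d)
    (R : realType) (mu : {measure set T -> \bar R}) (P : R -> L2 mu -> L2 mu) :
    \bar R :=
  ereal_inf [set Dirichlet_form P f |
    f in [set f | Dirichlet_domain P f /\ L2norm mu f = 1]].

Definition decay_rate (d : measure_display) (T : measurableType d)
    (R : realType) (mu : {measure set T -> \bar R}) (P : R -> L2 mu -> L2 mu)
    (eps : R) : Prop :=
  forall (t : R) (f : L2 mu), 0 <= t ->
    L2norm mu (P t f) <= L2norm mu f * expR (- eps * t).

(* Main.v *)
Require Import Defs.
From mathcomp Require Import all_boot all_order all_algebra.
From mathcomp Require Import all_classical all_reals all_analysis.
From mathcomp Require Import measurable_realfun ring lra.

Set Implicit Arguments.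
Unset Strict Implicit.
Unset Printing Implicit Defensive.

Import Order.TTheory GRing.Theory Num.Theory.
Import numFieldNormedType.Exports.

Local Open Scope classical_set_scope.
Local Open Scope ring_scope.

(* The function phi(t) = (P_t f, f) = ‖P_{t/2} f‖^2 is bounded and, by
   (u, v) <= (‖u‖^2 + ‖v‖^2) / 2, midpoint convex; hence it is convex, and the
   quotients (phi(0) - phi(t)) / t increase to D(f) as t decreases to 0.
   Applied to g = P_{t/2} f, for which (P_s g, g) = phi(t + s), convexity gives
   lambda0 phi(t) <= D(g) <= (phi(t - h) - phi(t)) / h. Thus
   (1 + lambda0 h) phi(t) <= phi(t - h), and iterating with h = t / n yields
   the exponential decay, without spectral theory or differentiation.
   Conversely, phi(t) <= exp(- eps t) forces D(f) >= eps when ‖f‖ = 1.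
   Non-ergodicity only serves to exclude L^2(mu) = 0. *)

(** * Convexity from midpoint convexity and boundedness *)

Lemma bounded_midpoint_convex (R : realType) (f : R -> R) (a b M : R) :
  (forall x y, a <= x <= b -> a <= y <= b ->
    f ((x + y) / 2) <= (f x + f y) / 2) ->
  (forall x, a <= x <= b -> f x <= M) ->
  forall c, a <= c <= b -> (b - a) * f c <= (b - c) * f a + (c - a) * f b.
Proof.
move=> fmid fM c cab.
(* [g] is [b - a] times the gap between [f] and its chord, so the claim reads [g c <= 0]. *)
pose g x := (b - a) * f x - (b - x) * f a - (x - a) * f b.
pose S := g @` [set x | a <= x <= b].
have ab : a <= b by lra.
have ga : g a = 0 by rewrite /g; ring.
have gb : g b = 0 by rewrite /g; ring.
have gmid x y : a <= x <= b -> a <= y <= b -> g ((x + y) / 2) <= (g x + g y) / 2.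
  move=> xab yab; have := fmid x y xab yab.
  have ba : 0 <= b - a by lra.
  by move=> /(ler_wpM2l ba); rewrite /g; lra.
have S0 : S !=set0 by exists (g a); exists a => //=; rewrite lexx.
have ubS : has_ubound S.
  exists ((b - a) * M + (b - a) * `|f a| + (b - a) * `|f b|).
  move=> _ [x /= xab <-]; rewrite /g.
  have h1 : (b - a) * f x <= (b - a) * M.
    by apply: ler_wpM2l; [lra|exact: fM].
  have h2 : - (b - x) * f a <= (b - a) * `|f a|.
    apply: le_trans (ler_norm _) _; rewrite normrM normrN.
    by apply: ler_wpM2r => //; rewrite ger0_norm; lra.
  have h3 : - (x - a) * f b <= (b - a) * `|f b|.
    apply: le_trans (ler_norm _) _; rewrite normrM normrN.
    by apply: ler_wpM2r => //; rewrite ger0_norm; lra.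
  lra.
have leS x : a <= x <= b -> g x <= sup S.
  by move=> xab; apply: ub_le_sup => //; exists x.
(* [x] is the midpoint of an endpoint, where [g] vanishes, and another point
   of the interval, so that [sup g <= sup g / 2] *)
have Shalf : sup S <= sup S / 2.
  apply: ge_sup => // _ [x /= xab <-].
  have [xm|mx] := leP x ((a + b) / 2).
    have h : a <= 2 * x - a <= b by lra.
    have := gmid a (2 * x - a) ltac:(lra) h; have := leS _ h.
    by rewrite (_ : (a + (2 * x - a)) / 2 = x) ?ga; [lra|field].
  have h : a <= 2 * x - b <= b by lra.
  have := gmid b (2 * x - b) ltac:(lra) h; have := leS _ h.
  by rewrite (_ : (b + (2 * x - b)) / 2 = x) ?gb; [lra|field].
by have := leS c cab; rewrite /g; lra.
Qed.

(** * Inner product and norm of L^2 on representatives *)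

Section L2_inner_product.
Context (d : measure_display) (T : measurableType d) (R : realType).
Variable mu : {measure set T -> \bar R}.
Implicit Types f g h : L2 mu.

Lemma L2_integrableM f g : mu.-integrable setT (EFin \o (fun x => f x * g x)).
Proof. by apply/Lfun1_integrable/Lfun2_mul_Lfun1; exact: LfunP. Qed.

Lemma L2innerC f g : L2inner mu f g = L2inner mu g f.
Proof. by apply: eq_Rintegral => x _; rewrite mulrC. Qed.

Lemma L2innerBl f g h :
  L2inner mu (f \- g) h = L2inner mu f h - L2inner mu g h.
Proof.
rewrite /L2inner -RintegralB//; try exact: L2_integrableM.
by apply: eq_Rintegral => x _ /=; rewrite mulrBl.
Qed.

Lemma L2innerZ a f g : L2inner mu (a *: f) (a *: g) = a ^+ 2 * L2inner mu f g.
Proof.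
rewrite /L2inner -RintegralZl//; last exact: L2_integrableM.
by apply: eq_Rintegral => x _ /=; rewrite expr2 mulrACA.
Qed.

Lemma L2inner_ael g f f' : f = f' %[ae mu] ->
  L2inner mu f g = L2inner mu f' g.
Proof.
move=> ff'; rewrite /L2inner /Rintegral; congr fine.
apply: ae_eq_integral => //.
- by apply/measurable_EFinP; exact: measurable_funM.
- by apply/measurable_EFinP; exact: measurable_funM.
- by apply: filterS ff' => x /= + _ => ->.
Qed.

Lemma L2inner_ge0 f : 0 <= L2inner mu f f.
Proof. by apply: Rintegral_ge0 => x _; rewrite -expr2 sqr_ge0. Qed.

Lemma L2norm_ge0 (f : T -> R) : 0 <= L2norm mu f.
Proof. by rewrite /L2norm fine_ge0// Lnorm_ge0. Qed.

Lemma L2norm_sqr f : L2norm mu f ^+ 2 = L2inner mu f f.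
Proof.
rewrite -powR_mulrn ?L2norm_ge0//; apply: EFin_inj.
rewrite -poweR_EFin /L2norm finite_norm_fine powR_Lnorm//.
rewrite /L2inner /Rintegral fineK; last first.
  by apply: integrable_fin_num => //; exact: L2_integrableM.
apply: eq_integral => x _ /=.
by rewrite powR_mulrn// real_normK ?num_real// expr2.
Qed.

Lemma L2inner_dist f g : L2inner mu (f - g) (f - g) =
  L2inner mu f f - 2 * L2inner mu f g + L2inner mu g g.
Proof.
have e (h : L2 mu) : L2inner mu (f - g) h = L2inner mu f h - L2inner mu g h.
  exact: L2innerBl.
by rewrite e (L2innerC f) (L2innerC g) !e (L2innerC g f); ring.
Qed.

(** The indicator of a set [F i] of finite measure lies in L^2, and its squared norm is
    [mu (F i)]. *)
Lemma L2_trivial_measure0 : sigma_finite setT mu ->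
  (forall f, L2inner mu f f = 0) -> mu setT = 0%E.
Proof.
move=> [F FT Ffin] L20; rewrite FT.
have F0 i : mu (F i) = 0%E.
  have [mF finF] := Ffin i.
  have int1 : (\int[mu]_x (\1_(F i) x)%:E = mu (F i))%E.
    by rewrite integral_indic// setIT.
  have F2 : (\1_(F i) : T -> R) \in Lfun mu 2%:E.
    apply/andP; split; rewrite inE/=; first exact: measurable_indic.
    rewrite /finite_norm unlock poweR_lty//.
    under eq_integral.
      move=> x _; rewrite (_ : (_ `^ _)%E = (\1_(F i) x)%:E); first over.
      rewrite /= indicE; case: (x \in F i) => /=.
        by rewrite normr1 powR1.
      by rewrite normr0 powR0.
    by rewrite int1.
  have := L20 (Lfun_Sub (lee1n 2) F2).
  rewrite /L2inner /Rintegral.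
  under eq_integral.
    move=> x _; rewrite (_ : (_ * _)%:E = (\1_(F i) x)%:E); first over.
    by rewrite /= indicE -natrM mulnb andbb.
  rewrite int1 => /eqP; rewrite fine_eq0; last first.
    by rewrite ge0_fin_numE.
  by move/eqP.
apply: measure_negligible; first by rewrite -FT.
by apply: negligible_bigcup => i; apply/negligibleP; [exact: (Ffin i).1|exact: F0].
Qed.

End L2_inner_product.

(** * Convexity of [phi] along the semigroup *)

Section semigroup.
Context (d : measure_display) (T : measurableType d) (R : realType).
Variables (mu : {measure set T -> \bar R}) (P : R -> L2 mu -> L2 mu).
Hypothesis hP : symmetric_Markov_semigroup P.
Implicit Types f g : L2 mu.

Local Notation phi f t := (L2inner mu (P t f) f).

(** Symmetry moves one operator across the inner product, and the semigroup law merges the two. *)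
Lemma semigroup_inner s t f : 0 <= s -> 0 <= t ->
  L2inner mu (P s f) (P t f) = phi f (s + t).
Proof.
move=> s0 t0; rewrite -(semigroup_symmetric hP) // addrC.
by apply/L2inner_ael/ae_eq_sym; exact: (semigroupD hP).
Qed.

Lemma semigroup_sqr t f : 0 <= t ->
  L2inner mu (P t f) (P t f) = phi f (t + t).
Proof. by move=> t0; rewrite semigroup_inner. Qed.

Lemma semigroup_half t f : 0 <= t ->
  phi f t = L2inner mu (P (t / 2) f) (P (t / 2) f).
Proof. by move=> t0; rewrite semigroup_sqr -?splitr// divr_ge0. Qed.

Lemma phi0 f : phi f 0 = L2inner mu f f.
Proof. by apply/L2inner_ael; exact: (semigroup0 hP). Qed.

Lemma phi_ge0 f t : 0 <= t -> 0 <= phi f t.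
Proof. by move=> t0; rewrite semigroup_half// L2inner_ge0. Qed.

Lemma phi_shift s t f : 0 <= s -> 0 <= t -> phi (P s f) t = phi f (s + s + t).
Proof.
move=> s0 t0; rewrite -addrA (addrC s) -semigroup_inner ?addr_ge0// addrC.
by apply/L2inner_ael/ae_eq_sym; exact: (semigroupD hP).
Qed.

Lemma phi_le0 f t : 0 <= t -> phi f t <= phi f 0.
Proof.
move=> t0; rewrite semigroup_half// phi0 -!L2norm_sqr.
by rewrite ler_sqr ?nnegrE ?L2norm_ge0// semigroup_contraction// divr_ge0.
Qed.

Lemma phi_midpoint f s t : 0 <= s -> 0 <= t ->
  phi f ((s + t) / 2) <= (phi f s + phi f t) / 2.
Proof.
move=> s0 t0; rewrite mulrDl -semigroup_inner ?divr_ge0//.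
rewrite (@semigroup_half s)// (@semigroup_half t)//.
(* Expanding [‖P_{s/2} f - P_{t/2} f‖^2 >= 0] gives the inequality. *)
have := L2inner_ge0 (P (s / 2) f - P (t / 2) f).
by rewrite L2inner_dist; lra.
Qed.

Lemma phi_convex f a b c : 0 <= a -> a <= c <= b ->
  (b - a) * phi f c <= (b - c) * phi f a + (c - a) * phi f b.
Proof.
move=> a0 cab; apply: (@bounded_midpoint_convex _ (fun t => phi f t) _ _ (phi f 0)) => //.
  by move=> x y xab yab; apply: phi_midpoint; lra.
by move=> x xab; apply: phi_le0; lra.
Qed.

(** By convexity the chord over [[t, t + s]] falls no more steeply than the one over [[t - h, t]];
    [h <= t] keeps all times nonnegative. *)
Lemma phi_slopes f h s t : 0 < h -> 0 < s -> h <= t ->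
  s^-1 * (phi f t - phi f (t + s)) <= h^-1 * (phi f (t - h) - phi f t).
Proof.
move=> h0 s0 ht.
have := @phi_convex f (t - h) (t + s) t ltac:(lra) ltac:(lra).
rewrite ler_pdivrMl// mulrCA ler_pdivlMl//; lra.
Qed.

(** * The Dirichlet form as a supremum of difference quotients *)

Lemma Dirichlet_quotient_le f s t : 0 < s -> s <= t ->
  t^-1 * (phi f 0 - phi f t) <= s^-1 * (phi f 0 - phi f s).
Proof.
move=> s0 st; have t0 : 0 < t by lra.
have := @phi_convex f 0 t s ltac:(lra) ltac:(lra).
rewrite ler_pdivrMl// mulrCA ler_pdivlMl//; lra.
Qed.

Lemma Dirichlet_form_sup f : Dirichlet_form P f =
  ereal_sup [set (t^-1 * (phi f 0 - phi f t))%:E | t in [set t | 0 < t]].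
Proof.
rewrite /Dirichlet_form.
under eq_fun do rewrite L2innerBl -phi0.
apply/cvg_lim => //.
rewrite [X in ereal_sup (_ @` X)](_ : _ = [set` `]0, +oo[]); last first.
  by apply/seteqP; split => x /=; rewrite in_itv/= andbT.
apply: nonincreasing_at_right_cvge => //.
move=> s t; rewrite !in_itv/= !andbT => s0 t0 st.
by rewrite lee_fin Dirichlet_quotient_le.
Qed.

Lemma Dirichlet_form_ge f t : 0 < t ->
  ((t^-1 * (phi f 0 - phi f t))%:E <= Dirichlet_form P f)%E.
Proof.
by move=> t0; rewrite Dirichlet_form_sup; apply: ereal_sup_ubound; exists t.
Qed.

Lemma Dirichlet_form_le f M :
  (forall t, 0 < t -> t^-1 * (phi f 0 - phi f t) <= M) ->
  (Dirichlet_form P f <= M%:E)%E.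
Proof.
move=> fM; rewrite Dirichlet_form_sup; apply: ge_ereal_sup => _ [t /= t0 <-].
by rewrite lee_fin fM.
Qed.

Lemma Dirichlet_form_ge0 f : (0 <= Dirichlet_form P f)%E.
Proof.
apply: le_trans (Dirichlet_form_ge f ltr01).
by rewrite lee_fin invr1 mul1r subr_ge0 phi_le0.
Qed.

Lemma phiZ a f t : 0 <= t -> phi (a *: f) t = a ^+ 2 * phi f t.
Proof.
move=> t0; have e : P t (a *: f) = a *: P t f %[ae mu].
  (* Linearity is available only for [a *: f + g]; this splitting avoids treating [P t 0]
     separately. *)
  have af : a *: f = (a - 1) *: f + f.
    by rewrite -[in X in _ + X](scale1r f) -scalerDl subrK.
  apply: filterS (semigroup_linear hP (a - 1) f f t0) => x /(_ I) /= fx _.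
  by rewrite af fx -[RHS]/(a * P t f x); ring.
rewrite (L2inner_ael (a *: f) e).
have e2 g : L2inner mu (a *: g) (a *: f) = a ^+ 2 * L2inner mu g f.
  rewrite /L2inner -RintegralZl//; last exact: L2_integrableM.
  by apply: eq_Rintegral => x _ /=; rewrite expr2 mulrACA.
exact: e2.
Qed.

(** * Bounds on [lambda0] and exponential decay *)

Lemma lambda0_ge0 : (0 <= lambda0 P)%E.
Proof. by apply: le_ereal_inf_tmp => _ [f _ <-]; exact: Dirichlet_form_ge0. Qed.

(** Normalising [f] gives a competitor in the infimum; the finite bound [M] also puts it in the
    domain. *)
Lemma lambda0_le f M : 0 < L2inner mu f f ->
  (forall t, 0 < t -> t^-1 * (phi f 0 - phi f t) <= M) ->
  (lambda0 P <= (M / L2inner mu f f)%:E)%E.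
Proof.
move=> f0 fM; set c := (L2norm mu f)^-1.
have c2 : c ^+ 2 = (L2inner mu f f)^-1 by rewrite exprVn L2norm_sqr.
have Dcf : (Dirichlet_form P (c *: f) <= (M / L2inner mu f f)%:E)%E.
  apply: Dirichlet_form_le => t t0.
  rewrite !phiZ ?(ltW t0)// -mulrBr mulrCA c2 mulrC.
  by rewrite ler_pM2r ?invr_gt0// fM.
apply: (le_trans _ Dcf); apply: ereal_inf_lbound; exists (c *: f) => //; split.
  rewrite /Dirichlet_domain/= ge0_fin_numE ?Dirichlet_form_ge0//.
  exact: le_lt_trans Dcf (ltry _).
apply/eqP; rewrite -(@eqrXn2 _ 2)// ?L2norm_ge0//.
by rewrite L2norm_sqr L2innerZ c2 mulVf ?expr1n// gt_eqF.
Qed.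

Lemma phi_decay_step l f h t : lambda0 P = l%:E -> 0 < h -> h <= t ->
  (1 + l * h) * phi f t <= phi f (t - h).
Proof.
move=> lE h0 ht; have t0 : 0 <= t by lra.
(* If [phi f t = 0], then [P (t / 2) f] cannot be normalised, but the left-hand side vanishes. *)
have [f0|f0] := ltP 0 (phi f t); last first.
  have -> : phi f t = 0 by apply/le_anti; rewrite f0 phi_ge0.
  by rewrite mulr0 phi_ge0//; lra.
have := @lambda0_le (P (t / 2) f) (h^-1 * (phi f (t - h) - phi f t)).
rewrite -semigroup_half// lE lee_fin ler_pdivlMr// ler_pdivlMl//.
suff H : forall s, 0 < s ->
    s^-1 * (phi (P (t / 2) f) 0 - phi (P (t / 2) f) s) <=
    h^-1 * (phi f (t - h) - phi f t).
  by move=> /(_ f0 H); lra.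
move=> s s0; rewrite !phi_shift ?divr_ge0 ?(ltW s0)// -!splitr addr0.
exact: phi_slopes.
Qed.

Lemma phi_decay_iter l f h n : lambda0 P = l%:E -> 0 < h ->
  (1 + l * h) ^+ n * phi f (n%:R * h) <= phi f 0.
Proof.
move=> lE h0.
have l0 : 0 <= l by rewrite -lee_fin -lE lambda0_ge0.
elim: n => [|n IH]; first by rewrite expr0 mul1r mul0r.
apply: le_trans IH; rewrite exprSr -mulrA ler_wpM2l//.
  by rewrite exprn_ge0// addr_ge0// mulr_ge0// ltW.
have <- : n.+1%:R * h - h = n%:R * h by rewrite -addn1 natrD; ring.
apply: phi_decay_step => //.
by rewrite ler_peMl ?ler1n// ltW.
Qed.

(* The iterates give [phi t (1 + l t / n)^n <= phi 0]; in the limit,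
   [1 + x >= exp (x / (1 + x))] turns the power into an exponential. *)
Lemma phi_decay l f t : lambda0 P = l%:E -> 0 <= t ->
  phi f t * expR (l * t) <= phi f 0.
Proof.
move=> lE; rewrite le_eqVlt => /predU1P[<-|t0].
  by rewrite mulr0 expR0 mulr1.
have l0 : 0 <= l by rewrite -lee_fin -lE lambda0_ge0.
have lt0 : 0 <= l * t by rewrite mulr_ge0// ltW.
have bound n : phi f t * expR (l * t / (1 + l * t * n.+1%:R^-1)) <= phi f 0.
  set x := l * t * n.+1%:R^-1.
  have x0 : 0 <= x by rewrite mulr_ge0.
  have := @phi_decay_iter l f (t / n.+1%:R) n.+1 lE.
  rewrite divr_gt0// => /(_ isT); apply: le_trans.
  rewrite [n.+1%:R * _]mulrC divfK// mulrA -/x [leRHS]mulrC ler_wpM2l ?phi_ge0 ?(ltW t0)//.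
  have -> : l * t / (1 + x) = n.+1%:R * (x / (1 + x)).
    by rewrite mulrA /x mulrCA divff// mulr1.
  rewrite expRM_natl lerXn2r ?nnegrE ?expR_ge0 ?addr_ge0//.
  have x1 : 0 < 1 + x by rewrite ltr_pwDl.
  (* After inversion this is [1 - y <= exp (- y)] at [y = x / (1 + x)], since
     [1 - y = (1 + x)^-1]. *)
  rewrite -[leRHS]invrK -[leLHS]invrK lef_pV2 ?posrE ?invr_gt0 ?expR_gt0//.
  rewrite -expRN; apply: le_trans (expR_ge1Dx _).
  by rewrite [leRHS](_ : _ = (1 + x)^-1)//; field; rewrite gt_eqF.
have cv : phi f t * expR (l * t / (1 + l * t * n.+1%:R^-1)) @[n --> \oo] -->
    phi f t * expR (l * t / (1 + l * t * 0)).
  apply: cvgM; first exact: cvg_cst.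
  apply: continuous_cvg; first exact: continuous_expR.
  apply: cvgM; first exact: cvg_cst.
  apply: cvgV; first by rewrite mulr0 addr0 oner_neq0.
  apply: cvgD; first exact: cvg_cst.
  by apply: cvgM; [exact: cvg_cst|exact: cvg_harmonic].
have : phi f t * expR (l * t / (1 + l * t * 0)) <= phi f 0.
  by apply: (cvgr_to_le cv); exact: nearW.
by rewrite mulr0 addr0 divr1.
Qed.

(** Since [‖P_t f‖^2 = phi (2 t)], the squared claim is the decay of [phi] at time [2 t]. *)
Lemma decay_rate_lambda0 l : lambda0 P = l%:E -> decay_rate P l.
Proof.
move=> lE t f t0.
rewrite -(@ler_pXn2r _ 2)// ?nnegrE ?mulr_ge0 ?L2norm_ge0 ?expR_ge0//.
rewrite exprMn !L2norm_sqr semigroup_sqr// -phi0 -expRM_natl mulNr mulrN expRN.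
rewrite ler_pdivlMr ?expR_gt0// mulrCA mulr_natl -mulr2n.
by apply: phi_decay => //; rewrite mulrn_wge0.
Qed.

(** * Optimality and finiteness of [lambda0] *)

Lemma decay_rate_le_lambda0 eps : decay_rate P eps -> (eps%:E <= lambda0 P)%E.
Proof.
move=> deps; apply: le_ereal_inf_tmp => _ [f [fD f1] <-].
have [eps0|eps0] := leP eps 0.
  by apply: le_trans (Dirichlet_form_ge0 f); rewrite lee_fin.
have ff1 : L2inner mu f f = 1 by rewrite -L2norm_sqr f1 expr1n.
have DE : Dirichlet_form P f = (fine (Dirichlet_form P f))%:E.
  by rewrite fineK.
rewrite DE lee_fin; set M := fine _.
have M0 : 0 <= M by rewrite -lee_fin -DE Dirichlet_form_ge0.
(* This [t] is small enough that [M * (eps * t) <= e]; [M + 1] keeps the denominator positive when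
   [M = 0]. *)
apply/ler_addgt0Pr => e e0; pose t := e / (eps * (M + 1)).
have t0 : 0 < t by rewrite divr_gt0// mulr_gt0// ltr_wpDl.
have := Dirichlet_form_ge f t0; rewrite DE lee_fin -/M phi0 ff1 ler_pdivrMl//.
have phit : phi f t * (1 + eps * t) <= 1.
  apply: (@le_trans _ _ (phi f t * expR (eps * t))).
    by rewrite ler_wpM2l ?phi_ge0 ?expR_ge1Dx// ltW.
  have t2 : 0 <= t / 2 by rewrite divr_ge0// ltW.
  have := deps _ f t2; rewrite f1 mul1r.
  rewrite -(@ler_pXn2r _ 2)// ?nnegrE ?L2norm_ge0 ?expR_ge0//.
  rewrite L2norm_sqr -semigroup_half ?(ltW t0)// -expRM_natl.
  rewrite (_ : 2%:R * (- eps * (t / 2)) = - (eps * t)); last by field.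
  rewrite expRN.
  by rewrite -ler_pdivlMr ?expR_gt0// div1r.
have Mt : M * (eps * t) <= e.
  rewrite (_ : M * (eps * t) = e * (M / (M + 1))); last first.
    by rewrite /t; field; rewrite !gt_eqF// ltr_wpDl.
  by rewrite ler_piMr ?(ltW e0)// ler_pdivrMr ?ltr_wpDl// mul1r lerDl.
have et0 : 0 < 1 + eps * t by rewrite addr_gt0// mulr_gt0.
(* Multiplying [1 - phi t <= t M] by [1 + eps t] and using [phit] leaves [eps <= M + M eps t]. *)
move=> /(ler_wpM2r (ltW et0)) h.
have : t * eps <= t * (M * (1 + eps * t)) by lra.
rewrite ler_pM2l//; lra.
Qed.

(* If [phi s = 0] then [‖P_s f - f‖^2 >= ‖f‖^2], which strong continuity excludes
   for small [s]; and [P_{s/2} f] always has finite energy by convexity. *)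
Lemma lambda0_lty f : 0 < L2inner mu f f -> (lambda0 P < +oo)%E.
Proof.
move=> f0.
have nf0 : 0 < L2norm mu f.
  rewrite lt_def L2norm_ge0 andbT; apply/eqP => e.
  by move: f0; rewrite -L2norm_sqr e expr0n ltxx.
have [s s0 Psf] : exists2 s, 0 < s & L2norm mu (P s f \- f) < L2norm mu f.
  near (0 : R)^'+ => s; exists s => //; near: s.
  have := semigroup_strongly_continuous hP f.
  by move=> /cvgr_lt; apply.
have phis : 0 < phi f s.
  have : L2norm mu (P s f - f) ^+ 2 < L2norm mu f ^+ 2.
    by rewrite ltr_pXn2r// nnegrE L2norm_ge0.
  rewrite !L2norm_sqr L2inner_dist semigroup_sqr ?(ltW s0)//.
  by have := @phi_ge0 f (s + s) ltac:(lra); lra.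
have g0 : 0 < L2inner mu (P (s / 2) f) (P (s / 2) f).
  by rewrite -semigroup_half// ltW.
apply: le_lt_trans (lambda0_le g0 _) (ltry _) => t t0.
rewrite !phi_shift ?divr_ge0 ?(ltW s0) ?(ltW t0)// -!splitr addr0.
(* The chord of [phi] over [[0, s]] bounds every difference quotient of [P (s / 2) f]. *)
exact: (@phi_slopes f s t s).
Unshelve. all: by end_near. Qed.

End semigroup.

(** * Non-ergodicity and the conclusion *)

Lemma nonergodic_L2_nontrivial (d : measure_display) (T : measurableType d)
    (R : realType) (mu : {measure set T -> \bar R}) (P : R -> L2 mu -> L2 mu) :
  sigma_finite setT mu -> ~ ergodic P -> exists f : L2 mu, 0 < L2inner mu f f.
Proof.
move=> sfin nerg; apply: contrapT => /forallNP L20; apply: nerg.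
have mu0 : mu setT = 0%E.
  apply: L2_trivial_measure0 => // f.
  by apply/eqP; rewrite eq_le L2inner_ge0 andbT leNgt; exact/negP.
split=> [|f]; first by rewrite mu0.
(* On a null space every integral vanishes, so these norms are 0 whatever the subtracted
   constant. *)
rewrite (_ : (fun t => _) = cst 0); first exact: cvg_cst.
apply/funext => t; rewrite /L2norm unlock null_set_integral//.
  by rewrite poweR0r// invr_eq0.
apply: (measurableT_comp (measurable_poweR _)).
apply: measurableT_comp => //; apply/measurable_EFinP.
by apply: measurable_funB => //; exact: measurable_funP.
Qed.

Theorem proposition1p1 (d : measure_display) (T : measurableType d)
    (R : realType) (mu : {sigma_finite_measure set T -> \bar R})
    (P : R -> L2 mu -> L2 mu) :
  symmetric_Markov_semigroup P ->
  ~ ergodic P ->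
  exists2 l : R, lambda0 P = l%:E &
    decay_rate P l /\ (forall eps : R, decay_rate P eps -> eps <= l).
Proof.
move=> hP /(nonergodic_L2_nontrivial (sigma_finiteT mu))[f f0].
(* A nonzero [f] keeps the infimum from being taken over the empty set, so [lambda0] is real. *)
have lE : lambda0 P = (fine (lambda0 P))%:E.
  by rewrite fineK// ge0_fin_numE ?(lambda0_ge0 hP)// (lambda0_lty hP f0).
exists (fine (lambda0 P)) => //; split; first exact: decay_rate_lambda0.
by move=> eps /(decay_rate_le_lambda0 hP); rewrite lE lee_fin.
Qed.
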